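(* For every integer $n\ge 0$ and every tree $T\in\mathcal{T}(4n+2)$, the number $-1$ is an eigenvalue of the distance matrix $D(T)$.
   Context: For a connected graph $G$ with vertices $v_1,\ldots,v_m$, the distance matrix $D(G)$ is the $m\times m$ real symmetric matrix whose $(i,j)$-entry is the length of a shortest path from $v_i$ to $v_j$. $P_k$ denotes the path on $k$ vertices. The sets $\mathcal{T}(4n+2)$ of trees on $4n+2$ vertices are defined recursively: $\mathcal{T}(2)=\{P_2\}$, and for $n\ge 1$, $\mathcal{T}(4n+2)$ is the set of all trees obtained by taking an arbitrary tree $T'\in\mathcal{T}(4n-2)$ and an arbitrary vertex $v$ of $T'$, taking a disjoint copy of $P_4$, and adding an edge joining an endvertex of this $P_4$ to $v$. *)

(* Defs.v *)
From HB Require Import structures.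
From mathcomp Require Import all_boot all_order all_algebra reals.
Set Implicit Arguments.
Unset Strict Implicit.
Unset Printing Implicit Defensive.
Import GRing.Theory.
Local Open Scope ring_scope.

Record sgraph := SGraph {
  vertex :> finType;
  edge : rel vertex;
  edge_sym : symmetric edge;
  edge_irrefl : irreflexive edge }.
Arguments edge {s} x y.

Definition giso (G H : sgraph) : Prop :=
  exists2 f : G -> H, bijective f & forall x y, edge (f x) (f y) = edge x y.

Definition connected_graph (G : sgraph) : Prop := forall x y : G, connect edge x y.

Definition has_path_of_length (G : sgraph) (x y : G) (k : nat) : bool :=
  [exists p : k.-tuple G, [&& path edge x p, last x p == y & uniq (x :: p)]].

(* A path has fewer than #|G| edges, so it is enough to search the lengths     *)
(* 0, ..., #|G| - 1; the value is #|G| (junk) when y is unreachable from x.    *)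
Definition gdist (G : sgraph) (x y : G) : nat :=
  find (has_path_of_length x y) (iota 0 #|G|).

Definition distance_matrix (R : realType) (G : sgraph) : 'M[R]_#|G| :=
  \matrix_(i, j) (gdist (enum_val i) (enum_val j))%:R.

Section PathGraph.
Variable k : nat.

Definition path_edge : rel 'I_k := fun i j => (i.+1 == j :> nat) || (j.+1 == i :> nat).

Lemma path_edge_sym : symmetric path_edge.
Proof. by move=> i j; rewrite /path_edge orbC. Qed.

Lemma path_edge_irrefl : irreflexive path_edge.
Proof. by move=> i; rewrite /path_edge orbb gtn_eqF. Qed.

Definition path_graph := SGraph path_edge_sym path_edge_irrefl.
End PathGraph.

Definition endvertex (G : sgraph) (x : G) : bool := #|[set y | edge x y]| == 1%N.

Section Bridge.
Variables (G : sgraph) (v : G) (H : sgraph) (u : H).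

Definition bridge_edge : rel (G + H)%type := fun a b =>
  match a, b with
  | inl x, inl y => edge x y
  | inr x, inr y => edge x y
  | inl x, inr y => (x == v) && (y == u)
  | inr x, inl y => (x == u) && (y == v)
  end.

Lemma bridge_edge_sym : symmetric bridge_edge.
Proof. by move=> [x|x] [y|y] /=; rewrite 1?edge_sym 1?andbC. Qed.

Lemma bridge_edge_irrefl : irreflexive bridge_edge.
Proof. by move=> [x|x] /=; rewrite edge_irrefl. Qed.

(* The disjoint union of G and H together with the edge vu. *)
Definition bridge := SGraph bridge_edge_sym bridge_edge_irrefl.
End Bridge.

(* calT n is the class T(4n+2), closed under isomorphism.  That its members    *)
(* are trees is not imposed: it is a consequence of the construction.          *)
Fixpoint calT (n : nat) (T : sgraph) : Prop :=
  match n with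
  | 0 => giso T (path_graph 2)
  | n'.+1 => exists (T' : sgraph) (v : T') (u : path_graph 4),
      [/\ calT n' T', endvertex u & giso T (bridge v u)]
  end.

Lemma gdistP (G : sgraph) (x y : G) : connect edge x y ->
  has_path_of_length x y (gdist x y) /\
  forall k, has_path_of_length x y k -> (gdist x y <= k)%N.
Proof.
move=> /connectP[p ep ->]; case/shortenP: ep => q eq uq _ {p}.
set y' := last x q.
have lt_size k : has_path_of_length x y' k -> (k < #|G|)%N.
  case/existsP=> r /and3P[_ _ /card_uniqP ur].
  by have := max_card (mem (x :: r)); rewrite ur /= size_tuple.
have hq : has_path_of_length x y' (size q).
  by apply/existsP; exists (in_tuple q); rewrite /= eq eqxx.
have hh : has (has_path_of_length x y') (iota 0 #|G|).
  by apply/hasP; exists (size q); rewrite // mem_iota /= lt_size.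
split.
  have := nth_find 0%N hh; rewrite nth_iota //.
  by have := hh; rewrite has_find size_iota.
move=> k hk; rewrite leqNgt; apply/negP => lt_k.
have := before_find 0%N lt_k.
by rewrite nth_iota ?add0n ?hk // lt_size.
Qed.

Lemma giso_connected (G H : sgraph) : giso G H -> connected_graph H -> connected_graph G.
Proof.
case=> f [g fK gK] ef cH x y.
have eg a b : edge (g a) (g b) = edge a b by rewrite -ef !gK.
have /connectP[p ep lp] := cH (f x) (f y).
apply/connectP; exists (map g p); last by rewrite -{1}(fK x) last_map -lp fK.
by rewrite -{1}(fK x) path_map; rewrite (eq_path (e' := edge)).
Qed.

Lemma path_graph_connected k : connected_graph (path_graph k).
Proof.
have up d (i j : path_graph k) : (j = i + d :> nat)%N -> connect edge i j.
  elim: d j => [|d IH] j jE; first by rewrite (_ : j = i) //; apply: val_inj; rewrite /= jE addn0.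
  have lt : (i + d < k)%N by apply: leq_ltn_trans (ltn_ord j); rewrite jE leq_add2l.
  apply: connect_trans (IH (Ordinal lt) erefl) (connect1 _).
  by rewrite /edge /= /path_edge /= jE addnS eqxx.
have sym : connect_sym (@edge (path_graph k)) by apply: sym_connect_sym; apply: edge_sym.
move=> i j; case: (leqP i j) => [ij|/ltnW ij]; last rewrite sym.
  by apply: (up (j - i)%N); rewrite subnKC.
by apply: (up (i - j)%N); rewrite subnKC.
Qed.

Lemma bridge_connected (G : sgraph) (v : G) (H : sgraph) (u : H) :
  connected_graph G -> connected_graph H -> connected_graph (bridge v u).
Proof.
move=> cG cH; pose B := bridge v u.
have sym : connect_sym (@edge B) by apply: sym_connect_sym; apply: edge_sym.
have cl x y : connect (@edge B) (inl x) (inl y).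
  have /connectP[p ep ->] := cG x y; apply/connectP; exists (map inl p); last by rewrite last_map.
  by rewrite path_map; rewrite (eq_path (e' := edge)).
have cr x y : connect (@edge B) (inr x) (inr y).
  have /connectP[p ep ->] := cH x y; apply/connectP; exists (map inr p); last by rewrite last_map.
  by rewrite path_map; rewrite (eq_path (e' := edge)).
have clr x y : connect (@edge B) (inl x) (inr y).
  apply: connect_trans (cl x v) (connect_trans (connect1 _) (cr u y)).
  by rewrite /edge /= !eqxx.
by case=> [x|x] [y|y] //; rewrite sym.
Qed.

Lemma calT_connected n T : calT n T -> connected_graph T.
Proof.
elim: n T => [|n IH] T; first by move/giso_connected; apply; apply: path_graph_connected.
case=> T' [v [u [cT' _ iT]]]; apply: giso_connected iT _.
by apply: bridge_connected (IH _ cT') (@path_graph_connected 4).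
Qed.

Lemma calT_card n T : calT n T -> #|T| = (4 * n + 2)%N.
Proof.
have cardE G H : giso G H -> #|G| = #|H| by case=> f /bij_eq_card.
elim: n T => [|n IH] T; first by move/cardE => ->; rewrite card_ord.
by case=> T' [v [u [/IH cT' _ /cardE ->]]]; rewrite card_sum cT' card_ord mulnS addnC addnA.
Qed.

(* Main.v *)
Require Import Defs.
From HB Require Import structures.
From mathcomp Require Import all_boot all_order all_algebra reals.
From mathcomp Require Import zify ring.
Import GRing.Theory.
Local Open Scope ring_scope.

(** Each step of the construction of the class extends a zero-sum eigenvector
    of the distance matrix for the eigenvalue -1.  Let z be such an eigenvector
    of a tree G, and attach an endvertex u of P_4 to the vertex v of G.  Put
    c = z(v) and continue z by c, -c, -c, c along P_4.  This continuation h
    satisfies sum_k h(k) = 0 and sum_k h(k) d(k, u) = 0, so a column of a vertex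
    y of G gains sum_k h(k) (d(k, u) + 1 + d(v, y)) = 0 from the new vertices and
    keeps its old value -z(y).  In the column of a vertex j of P_4, the old
    vertices contribute
      sum_w z(w) (d(w, v) + 1 + d(u, j)) = -z(v) = -c,
    because z has zero sum, and the new ones contribute c - h(j), by direct
    inspection of P_4; the total is -h(j).  The new vector again has zero sum,
    and the induction starts from (1, -1) on P_2.  The extension step is
    [eigvec_bridge], stated for an arbitrary attached graph.

    Explicit formulas for distances come from [gdist_metric]: a function
    obeying the three local rules of [graph_metric] is the graph distance.
    These rules are immediate for |i - j| on a path, for the piecewise formula
    on a bridge, and for the pullback along an isomorphism. *)

(** * Local characterization of the graph distance *)

(** The levels of a breadth-first search from x: an edge raises the level by at
    most one, and every vertex but x is reached from the preceding level.  These
    rules determine d, and force the graph to be connected. *)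
Definition graph_metric (G : sgraph) (d : G -> G -> nat) : Prop :=
  [/\ forall x, d x x = 0%N,
      forall x y z, edge y z -> (d x z <= (d x y).+1)%N &
      forall x y, x != y -> exists2 z, edge z y & d x y = (d x z).+1].

Lemma metric_le_path (G : sgraph) (d : G -> G -> nat) (x : G) (p : seq G) :
  graph_metric G d -> path edge x p -> (d x (last x p) <= size p)%N.
Proof.
case=> d0 dS _; elim/last_ind: p => [|p y IH]; first by rewrite d0.
rewrite rcons_path last_rcons size_rcons => /andP[/IH le_p /dS le_y].
exact: leq_trans (le_y x) _.
Qed.

Lemma metric_path (G : sgraph) (d : G -> G -> nat) (x y : G) :
  graph_metric G d ->
  exists p, [/\ path edge x p, last x p = y & size p = d x y].
Proof.
case=> d0 _ dP; move: {2}(d x y) (erefl (d x y)) => k.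
elim: k y => [|k IH] y dk.
  exists [::]; split=> //=; apply/eqP; apply: contra_eqT dk => /dP[z _ ->] //.
have /dP[z zy dE] : x != y by apply: contra_eq_neq dk => ->; rewrite d0.
have [|p [pp pz sp]] := IH z; first by apply: succn_inj; rewrite -dE.
by exists (rcons p y); rewrite rcons_path pp pz last_rcons size_rcons sp dE.
Qed.

(** A walk of length d x y shortens to a path, and by the Lipschitz rule no
    path is shorter than d x y. *)
Lemma gdist_metric (G : sgraph) (d : G -> G -> nat) (x y : G) :
  graph_metric G d -> gdist x y = d x y.
Proof.
move=> md; have [p [pp py sp]] := metric_path G d x y md.
have cxy : connect edge x y by apply/connectP; exists p.
have [/existsP[q /and3P[pq /eqP qy _]] gmin] := gdistP cxy.
apply/eqP; rewrite eqn_leq; apply/andP; split; last first.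
  by have := metric_le_path G d x q md pq; rewrite qy size_tuple.
move: py; rewrite -sp; case/shortenP: pp => r pr ur sub_r ry.
have le_rp : (size r <= size p)%N.
  by apply: uniq_leq_size sub_r; case/andP: ur.
apply: leq_trans le_rp; apply: gmin; apply/existsP; exists (in_tuple r).
by rewrite /= pr ry eqxx.
Qed.

Lemma metric_giso (G H : sgraph) (f : G -> H) (d : H -> H -> nat) :
  bijective f -> (forall x y, edge (f x) (f y) = edge x y) ->
  graph_metric H d -> graph_metric G (fun x y => d (f x) (f y)).
Proof.
move=> bf ef [d0 dS dP]; split=> [x|x y z yz|x y xy].
- exact: d0.
- by apply: dS; rewrite ef.
have [g fK gK] := bf.
have [|z zy dE] := dP (f x) (f y); first by rewrite (inj_eq (bij_inj bf)).
by exists (g z); rewrite -?ef gK.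
Qed.

Definition path_dist (k : nat) (i j : path_graph k) : nat := ((i - j) + (j - i))%N.

Lemma metric_path_graph (k : nat) : graph_metric (path_graph k) (path_dist k).
Proof.
rewrite /path_dist; split=> [x|x y z|x y]; first by rewrite subnn.
  by rewrite /edge /= /path_edge => /orP[] /eqP yz; lia.
have bound_y := ltn_ord y; have bound_x := ltn_ord x.
rewrite neq_ltn /= => /orP[] xy.
  have lt_z : (y.-1 < k)%N by lia.
  by exists (Ordinal lt_z); rewrite /edge /= /path_edge /=; lia.
have lt_z : (y.+1 < k)%N by lia.
by exists (Ordinal lt_z); rewrite /edge /= /path_edge /=; lia.
Qed.

Definition bridge_dist (G : sgraph) (v : G) (H : sgraph) (u : H)
    (d : G -> G -> nat) (e : H -> H -> nat) (a b : bridge v u) : nat :=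
  match a, b with
  | inl x, inl y => d x y
  | inr x, inr y => e x y
  | inl x, inr y => (d x v + (e u y).+1)%N
  | inr x, inl y => (e x u + (d v y).+1)%N
  end.

Lemma metric_bridge (G : sgraph) (v : G) (H : sgraph) (u : H)
    (d : G -> G -> nat) (e : H -> H -> nat) :
  graph_metric G d -> graph_metric H e ->
  graph_metric (bridge v u) (bridge_dist G v H u d e).
Proof.
move=> [d0 dS dP] [e0 eS eP]; split.
- by case=> x /=.
- move=> [x|x] [y|y] [z|z]; rewrite /edge /=.
  + exact: dS.
  + by case/andP=> /eqP-> /eqP->; rewrite e0 addn1.
  + by case/andP=> /eqP-> /eqP->; rewrite e0; lia.
  + by move=> /(eS u); lia.
  + by move=> /(dS v); lia.
  + by case/andP=> /eqP-> /eqP->; rewrite d0; lia.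
  + by case/andP=> /eqP-> /eqP->; rewrite d0 addn1.
  + exact: eS.
move=> [x|x] [y|y] /= xy.
- by have [z zy ->] := dP x y xy; exists (inl z).
- have [->|uy] := eqVneq y u.
    by exists (inl v); rewrite /edge /= ?eqxx // e0 addn1.
  have [|z zy ->] := eP u y; first by rewrite eq_sym.
  by exists (inr z) => //=; rewrite addnS.
- have [->|vy] := eqVneq y v.
    by exists (inr u); rewrite /edge /= ?eqxx // d0 addn1.
  have [|z zy ->] := dP v y; first by rewrite eq_sym.
  by exists (inl z) => //=; rewrite addnS.
by have [z zy ->] := eP x y xy; exists (inr z).
Qed.

(** * Zero-sum eigenvectors for the eigenvalue -1 *)

Definition zero_sum_eigvec (R : realType) (G : sgraph) (d : G -> G -> nat)
    (z : G -> R) : Prop :=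
  [/\ \sum_x z x = 0,
      forall y, \sum_x z x * (d x y)%:R = - z y &
      exists x, z x != 0].

Lemma eigenvalue_zero_sum_eigvec (R : realType) (G : sgraph)
    (d : G -> G -> nat) (z : G -> R) :
  graph_metric G d -> zero_sum_eigvec R G d z ->
  eigenvalue (distance_matrix R G) (-1).
Proof.
move=> md [_ zE [x zx]]; apply/eigenvalueP.
exists (\row_i z (enum_val i)); last first.
  apply: contraNneq zx => /rowP/(_ (enum_rank x)).
  by rewrite !mxE enum_rankK => ->.
apply/rowP=> j; rewrite !mxE mulN1r -zE.
rewrite [RHS](reindex _ (onW_bij _ (enum_val_bij G))) /=.
by apply: eq_bigr => i _; rewrite !mxE (gdist_metric G d _ _ md).
Qed.

Lemma eigvec_giso (R : realType) (G H : sgraph) (f : G -> H)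
    (d : H -> H -> nat) (z : H -> R) :
  bijective f -> zero_sum_eigvec R H d z ->
  zero_sum_eigvec R G (fun x y => d (f x) (f y)) (fun x => z (f x)).
Proof.
move=> bf [z0 zE [x zx]]; have [g fK gK] := bf; split.
- by rewrite -[RHS]z0 [RHS](reindex _ (onW_bij _ bf)).
- by move=> y; rewrite -zE [RHS](reindex _ (onW_bij _ bf)).
by exists (g x); rewrite gK.
Qed.

(** The conditions on h say that the attached graph H does not disturb the
    columns of G (the first two), and that in its own columns it leaves a
    constant defect (the third), which the term -z(v) coming from G cancels
    once h is scaled by z(v). *)
Lemma eigvec_bridge (R : realType) (G : sgraph) (v : G) (H : sgraph) (u : H)
    (d : G -> G -> nat) (e : H -> H -> nat) (z : G -> R) (h : H -> R) :
  e u u = 0%N -> d v v = 0%N ->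
  \sum_k h k = 0 -> \sum_k h k * (e k u)%:R = 0 ->
  (forall j, \sum_k h k * (e k j)%:R = 1 - h j) ->
  zero_sum_eigvec R G d z ->
  zero_sum_eigvec R (bridge v u) (bridge_dist G v H u d e)
    (fun a : bridge v u => match a with inl x => z x | inr k => z v * h k end).
Proof.
move=> e0 d0 h0 hu hE [z0 zE [x zx]]; split; last by exists (inl x).
- by rewrite big_sumType /= z0 -mulr_sumr h0 mulr0 addr0.
case=> [y|j]; rewrite big_sumType /=.
  rewrite zE (eq_bigr (fun k => z v * (h k * (e k u)%:R)
                                + z v * (h k * (d v y).+1%:R))); last first.
    by move=> k _; rewrite natrD mulrDr !mulrA.
  by rewrite big_split /= -!mulr_sumr -mulr_suml h0 hu mul0r mulr0 !addr0.
rewrite (eq_bigr (fun w => z w * (d w v)%:R + z w * (e u j).+1%:R)); last first.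
  by move=> w _; rewrite natrD mulrDr.
rewrite big_split /= zE -mulr_suml z0 mul0r addr0.
under eq_bigr do rewrite -mulrA.
by rewrite -mulr_sumr hE mulrBr mulr1 addKr.
Qed.

(** * The paths on two and four vertices *)

Lemma eigvec_path2 (R : realType) :
  zero_sum_eigvec R (path_graph 2) (path_dist 2) (fun i : 'I_2 => (-1) ^+ i).
Proof.
split.
- by rewrite !big_ord_recl big_ord0 /= expr0 expr1 addr0 subrr.
- case=> -[|[|//]] lt_i; rewrite !big_ord_recl big_ord0 /path_dist /=;
    rewrite /bump /= ?expr0 ?expr1 /subn /addn /=; ring.
by exists ord0; rewrite expr0 oner_neq0.
Qed.

Lemma endvertex_path4 (u : path_graph 4) :
  endvertex u -> u = 0%N :> nat \/ u = 3%N :> nat.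
Proof.
case/cards1P=> a /setP nbr.
have in_nbr (w : path_graph 4) : edge u w -> w = a.
  by move=> uw; apply/eqP; have := nbr w; rewrite !inE uw.
(* An inner vertex has two distinct neighbours, which would both equal a. *)
case: u nbr in_nbr => -[|[|[|[|//]]]] lt_u nbr in_nbr; [by left| | |by right].
- have := in_nbr (inord 0); rewrite -(in_nbr (inord 2)) /edge /= /path_edge.
    by rewrite !inordK // => /(_ isT)/(congr1 val); rewrite /= !inordK.
  by rewrite /= inordK.
have := in_nbr (inord 1); rewrite -(in_nbr (inord 3)) /edge /= /path_edge.
  by rewrite !inordK // => /(_ isT)/(congr1 val); rewrite /= !inordK.
by rewrite /= inordK.
Qed.

Definition alt4 (R : realType) (k : 'I_4) : R :=
  if (k == 0%N :> nat) || (k == 3%N :> nat) then 1 else -1.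

Lemma alt4_sum (R : realType) : \sum_k alt4 R k = 0.
Proof. by rewrite !big_ord_recl big_ord0 /alt4 /=; ring. Qed.

Lemma alt4_dist (R : realType) (j : path_graph 4) :
  \sum_k alt4 R k * (path_dist 4 k j)%:R = 1 - alt4 R j.
Proof.
case: j => -[|[|[|[|//]]]] lt_j;
  by rewrite !big_ord_recl big_ord0 /alt4 /path_dist /= /bump /subn /addn /=; ring.
Qed.

(** * The class of trees *)

(** The induction carries its own distance function along with the eigenvector,
    so that the explicit formulas compose from one step to the next; it is
    identified with the graph distance only once, at the end. *)
Lemma calT_eigvec (R : realType) (n : nat) (T : sgraph) : calT n T ->
  exists (d : T -> T -> nat) (z : T -> R),
    graph_metric T d /\ zero_sum_eigvec R T d z.
Proof.
elim: n T => [|n IH] T.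
  case=> f bf ef.
  exists (fun x y => path_dist 2 (f x) (f y)), (fun x => (-1) ^+ f x).
  split; first exact: metric_giso bf ef (metric_path_graph 2).
  exact: eigvec_giso R T _ f _ _ bf (eigvec_path2 R).
case=> T' [v [u [/IH[d [z [md ez]]] end_u [f bf ef]]]].
have mp := metric_path_graph 4.
have d0 : d v v = 0%N by case: md.
have p0 : path_dist 4 u u = 0%N by case: mp.
(* The endvertices carry the entry 1, so their defect 1 - h(u) vanishes. *)
have hu : \sum_k alt4 R k * (path_dist 4 k u)%:R = 0.
  rewrite alt4_dist /alt4.
  by case: (endvertex_path4 u end_u) => ->; rewrite subrr.
have mb := metric_bridge T' v _ u d _ md mp.
have eb := eigvec_bridge R T' v _ u d _ z (alt4 R) p0 d0
             (alt4_sum R) hu (alt4_dist R) ez.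
eexists; eexists; split; first exact: metric_giso bf ef mb.
exact: eigvec_giso bf eb.
Qed.

Theorem theorem1p5 (R : realType) (n : nat) (T : sgraph) (hT : calT n T) :
  eigenvalue (distance_matrix R T) (-1).
Proof.
have [d [z [md ez]]] := calT_eigvec R n T hT.
exact: eigenvalue_zero_sum_eigvec md ez.
Qed.
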